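(* Consider the round-robin tournament model $M_{[0,1]}$ with countable score set $D\subset[0,1]$, $|D|>1$ (the common distribution of the rewards $X_{ij}$ being fixed, not depending on $n$). Let $r_n(M_{[0,1]})$ be the probability that, in the tournament with $n$ players, there is a unique player with the maximum score, i.e. that there is exactly one $i\in\{1,\dots,n\}$ with $s_i(n)=\max\{s_1(n),\dots,s_n(n)\}$. Then $$\lim_{n\to\infty} r_n(M_{[0,1]})=1 .$$
   Context: Round-robin tournament: each of $n$ players plays once against each of the other $n-1$ players. When player $i$ plays player $j$ ($i\ne j$), player $i$'s reward is a random variable $X_{ij}$. The $\binom n2$ pairs $(X_{ij},X_{ji})$, $1\le i<j\le n$, are assumed independent. The score of player $i$ is $s_i(n)=\sum_{j=1,\,j\ne i}^n X_{ij}$. Model $M_{[0,1]}$: $D\subset[0,1]$ is a discrete (countable, i.e. finite or countably infinite) set, the set of all possible values of $X_{ij}$; each value in $D$ is attained with positive probability, $X_{ij}\in D$, and $|D|>1$. For all $i\neq j$, $X_{ij}+X_{ji}=1$. All players are equally strong, meaning that all $X_{ij}$ ($i\ne j$) have the same distribution; consequently $0<\mathbb{P}(X_{ij}=a)=\mathbb{P}(X_{ij}=1-a)$ for every $a\in D$. *)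

(* Defs.v *)
From mathcomp Require Import all_boot all_order all_algebra.
From mathcomp Require Import all_classical all_reals all_analysis.

Set Implicit Arguments.
Unset Strict Implicit.
Unset Printing Implicit Defensive.

Import Order.TTheory GRing.Theory Num.Theory.
Import numFieldNormedType.Exports.

Local Open Scope classical_set_scope.
Local Open Scope ring_scope.

Definition mutually_independent (R : realType) (d d' : measure_display)
    (T : measurableType d) (S : measurableType d') (P : probability T R)
    (I : finType) (Y : I -> T -> S) : Prop :=
  forall (J : {set I}) (B : I -> set S),
    (forall k, k \in J -> measurable (B k)) ->
    P (\bigcap_(k in [set` J]) (Y k @^-1` B k))
      = (\prod_(k in J) P (Y k @^-1` B k))%E.

Notation game n := {p : 'I_n * 'I_n | (p.1 < p.2)%N}.

Definition game_rewards (R : realType) (n : nat) (T : Type)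
    (X : 'I_n -> 'I_n -> T -> R) (g : game n) (w : T) : R * R :=
  (X (val g).1 (val g).2 w, X (val g).2 (val g).1 w).

(* The diagonal [X i i] carries no meaning and is never used. *)
Definition score (R : realType) (n : nat) (T : Type)
    (X : 'I_n -> 'I_n -> T -> R) (i : 'I_n) (w : T) : R :=
  \sum_(j < n | j != i) X i j w.

Definition has_max_score (R : realType) (n : nat) (T : Type)
    (X : 'I_n -> 'I_n -> T -> R) (w : T) (i : 'I_n) : Prop :=
  forall j : 'I_n, score X j w <= score X i w.

Definition unique_winner (R : realType) (n : nat) (T : Type)
    (X : 'I_n -> 'I_n -> T -> R) : set T :=
  [set w | exists! i : 'I_n, has_max_score X w i].

(* [mu] is a law carried by [D], which is the set of its atoms.  That [mu] gives
   full mass to [D] is imposed through [X i j] in [model01]. *)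
Record score_set (R : realType) (D : set R) (mu : probability R R) : Prop := {
  score_set_countable : countable D;
  score_set_01 : D `<=` `[0, 1];
  score_set_gt1 : exists a b : R, [/\ D a, D b & a != b];
  score_set_atom : forall a : R, D a -> (0 < mu [set a])%E }.

(* Pointwise relations between random variables are only required almost surely.
   Laws are compared on measurable sets only, since the values of a measure
   elsewhere are irrelevant. *)
Record model01 (R : realType) (D : set R) (mu : probability R R) (n : nat)
    (d : measure_display) (T : measurableType d) (P : probability T R)
    (X : 'I_n -> 'I_n -> {RV P >-> R}) : Prop := {
  model01_indep : mutually_independent P (game_rewards (fun i j => X i j));
  model01_val : forall i j : 'I_n, i != j -> {ae P, forall w, D (X i j w)};
  model01_sum : forall i j : 'I_n, i != j ->
    {ae P, forall w, X i j w + X j i w = 1};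
  model01_law : forall i j : 'I_n, i != j ->
    forall A : set R, measurable A -> distribution P (X i j) A = mu A }.

(* Main.v *)
Require Import Defs.
From mathcomp Require Import all_boot all_order all_algebra perm ring lra.
From mathcomp Require Import all_classical all_reals all_analysis measurable_realfun.

Set Implicit Arguments.
Unset Strict Implicit.
Unset Printing Implicit Defensive.

Import Order.TTheory GRing.Theory Num.Theory.
Import numFieldNormedType.Exports.

Local Open Scope classical_set_scope.
Local Open Scope ring_scope.

(** Let S be the sum of N independent rewards and F(u) = P(S >= u).  Everything
rests on a smoothness property of F, [tail_shift]: for fixed eps and L, once N
is large, F(u) <= (1 + eps) F(u + L) + eps / N for all u at once.  Let a < b be
atoms of mass p_a and p_b, and let N_a and N_b be the numbers of summands equal
to a and to b.  Turning one a into a b ([letter_exchange]) gives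
   p_b E[N_a ; S >= u] = p_a E[N_b ; S >= u + (b - a)],
and N_a, N_b are within a factor 1 + o(1) of N p_a, N p_b outside an event of
exponentially small probability ([occ_lower_deviation], [occ_upper_deviation]).
Hence F(u) and F(u + (b - a)) agree up to a factor 1 + o(1) and an exponentially
small error; finitely many such steps cover the distance L.

For n = N + 2 players, fix a large constant K and a point t such that
F(t + 1) < K / N <= F(t) ([tail_crossing]).  For two given players, the sums of their rewards
against the N others are independent with tail F, and they differ from the total
rewards by at most 1.
 - The number of players whose total reward is at least t has mean at least K.
   Two given players both reach t with probability at most F(t - 1)^2, which is
   F(t)^2 up to a factor 1 + o(1).  By [second_moment], the probability that
   nobody reaches t is at most 1 / K + o(1).
 - Two given players, the better of them reaching t, are within distance 1 with
   probability at most F(t - 1) sup (F(u) - F(u + 5)), the supremum being over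
   u >= t - 3 ([prob_near_tie_le]).  The first factor is O(K / N) and the second is
   o(K / N), so a sum over the n^2 pairs is o(1) when K is fixed.
Hence with probability tending to 1 the winner leads by more than 1
([clear_winner_whp]).

So large a lead tolerates rounding, which reduces the problem to finite
probability spaces: each reward is replaced by a letter that tells whether it is
a, b, or else its cell in a grid of mesh 1 / (n - 1).  This moves each score by
at most 1, so that a winner who leads by more than 1 after rounding is the unique
winner before ([discretization]). *)

Lemma ler_sum_subpred (R : numDomainType) (I : finType) (f : I -> R) (A B : pred I) :
  (forall i, 0 <= f i) -> (forall i, A i -> B i) ->
  \sum_(i | A i) f i <= \sum_(i | B i) f i.
Proof.
move=> f0 AB; rewrite [leRHS](bigID A)/=.
rewrite [in leRHS](eq_bigl A) ?lerDl ?sumr_ge0// => i.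
by apply: andb_idl; exact: AB.
Qed.

(** * Words of independent letters *)

Section IidLetters.
Context {R : realType} {V : finType} (w v : V -> R).

Definition word_weight N (z : {ffun 'I_N -> V}) : R := \prod_k w (z k).

Definition word_sum N (z : {ffun 'I_N -> V}) : R := \sum_k v (z k).

Definition occ (l : V) N (z : {ffun 'I_N -> V}) : R := \sum_k (z k == l)%:R.

Definition tail N (u : R) : R :=
  \sum_(z : {ffun 'I_N -> V} | u <= word_sum z) word_weight z.

Context (w_ge0 : forall l, 0 <= w l) (w_sum1 : \sum_l w l = 1).

Lemma word_weight_ge0 N (z : {ffun 'I_N -> V}) : 0 <= word_weight z.
Proof. exact: prodr_ge0. Qed.

Lemma sum_word_weight_prod N (f : V -> R) :
  \sum_(z : {ffun 'I_N -> V}) word_weight z * \prod_k f (z k)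
    = (\sum_l w l * f l) ^+ N.
Proof.
rewrite -[N in RHS]card_ord -prodr_const bigA_distr_bigA /=.
by apply: eq_bigr => z _; rewrite -big_split.
Qed.

Lemma sum_word_weight N : \sum_(z : {ffun 'I_N -> V}) word_weight z = 1.
Proof.
transitivity ((\sum_l w l * 1) ^+ N).
  rewrite -(sum_word_weight_prod N (fun=> 1)).
  by apply: eq_bigr => z _; rewrite big1 ?mulr1.
by under eq_bigr do rewrite mulr1; rewrite w_sum1 expr1n.
Qed.

Lemma tail_ge0 N u : 0 <= tail N u.
Proof. by apply: sumr_ge0 => z _; exact: word_weight_ge0. Qed.

Lemma sum_word_weight_cond N (A : pred {ffun 'I_N -> V}) :
  \sum_(z | A z) word_weight z = \sum_z word_weight z * (A z)%:R.
Proof.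
rewrite big_mkcond; apply: eq_bigr => z _.
by case: (A z); rewrite ?mulr1 ?mulr0.
Qed.

Lemma tail_le N u u' : u <= u' -> tail N u' <= tail N u.
Proof. by move=> uu'; apply: (ler_sum_subpred (@word_weight_ge0 _)) => z; exact: le_trans. Qed.

(** Replacing a marked occurrence of [al] by [be] matches the words with a marked
[al] to the words with a marked [be]; it multiplies the weight by [w be / w al]
and adds [v be - v al] to the sum. *)
Lemma letter_exchange N (al be : V) (f : R -> R) :
  w be * (\sum_(z : {ffun 'I_N -> V}) word_weight z * occ al z * f (word_sum z + (v be - v al)))
  = w al * (\sum_(z : {ffun 'I_N -> V}) word_weight z * occ be z * f (word_sum z)).
Proof.
have E l (g : R -> R) : \sum_(z : {ffun 'I_N -> V}) word_weight z * occ l z * g (word_sum z)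
   = \sum_(k < N) \sum_(z : {ffun 'I_N -> V} | z k == l) word_weight z * g (word_sum z).
  under [RHS]eq_bigr do rewrite big_mkcond.
  rewrite exchange_big; apply: eq_bigr => z _ /=.
  rewrite /occ mulr_sumr mulr_suml; apply: eq_bigr => k _.
  by case: ifP => _; rewrite ?mulr1 // mulr0 mul0r.
(* The swap of the two letters at the marked place [k] is an involution on words. *)
rewrite (E al (fun x => f (x + (v be - v al)))) E !mulr_sumr; apply: eq_bigr => k _.
pose h (z : {ffun 'I_N -> V}) : {ffun 'I_N -> V} :=
  [ffun j => if j == k then tperm al be (z j) else z j].
have hK : involutive h.
  by move=> z; apply/ffunP => j; rewrite !ffunE; case: eqP => // ->; rewrite tpermK.
rewrite !mulr_sumr [RHS](reindex_inj (inv_inj hK)) /=.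
rewrite [RHS](eq_bigl (fun z : {ffun 'I_N -> V} => z k == al)) => [|z].
  apply: eq_bigr => z /eqP zk.
  have hz j : j != k -> h z j = z j by rewrite ffunE => /negbTE ->.
  have hk : h z k = be by rewrite ffunE eqxx zk tpermL.
  have -> : word_weight (h z) = w be * \prod_(j | j != k) w (z j).
    by rewrite /word_weight (bigD1 k)//= hk; under eq_bigr do rewrite hz//.
  have -> : word_sum (h z) = v be + \sum_(j | j != k) v (z j).
    by rewrite /word_sum (bigD1 k)//= hk; under eq_bigr do rewrite hz//.
  have -> : word_weight z = w al * \prod_(j | j != k) w (z j).
    by rewrite /word_weight (bigD1 k)//= zk.
  have -> : word_sum z + (v be - v al) = v be + \sum_(j | j != k) v (z j).
    by rewrite /word_sum (bigD1 k)//= zk; ring.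
  ring.
by rewrite ffunE eqxx -[X in _ == X](tpermL al be) (inj_eq perm_inj).
Qed.

Lemma occ_ge0 l N (z : {ffun 'I_N -> V}) : 0 <= occ l z.
Proof. exact: sumr_ge0. Qed.

Lemma occ_le l N (z : {ffun 'I_N -> V}) : occ l z <= N%:R.
Proof.
rewrite -[in leRHS](card_ord N) -sum1_card natr_sum; apply: ler_sum => k _.
by case: (_ == _).
Qed.

Lemma letter_prob_le1 l : w l <= 1.
Proof. by rewrite -w_sum1 (bigD1 l)//= lerDl sumr_ge0. Qed.

Lemma sum_expR_occ N l (t : R) :
  \sum_(z : {ffun 'I_N -> V}) word_weight z * expR (t * occ l z)
    = (1 + w l * (expR t - 1)) ^+ N.
Proof.
transitivity (\sum_(z : {ffun 'I_N -> V}) word_weight z *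
    \prod_k expR (t * (z k == l)%:R)).
  by apply: eq_bigr => z _; rewrite mulr_sumr expR_sum.
rewrite (sum_word_weight_prod N (fun x => expR (t * (x == l)%:R))); congr (_ ^+ _).
rewrite (bigD1 l)//= eqxx mulr1.
rewrite [X in _ + X](eq_bigr w) => [|x /negbTE xl]; last first.
  by rewrite xl mulr0 expR0 mulr1.
have := w_sum1; rewrite (bigD1 l)//= => /(canRL (addKr _)) ->.
ring.
Qed.


(** * Concentration of the number of occurrences of a letter *)

(** The sign of [t] selects the tail: one exponential Markov inequality serves
both. *)
Lemma occ_chernoff N l (t y : R) : `|t| <= 2^-1 ->
  \sum_(z : {ffun 'I_N -> V} | y <= t * (occ l z - N%:R * w l)) word_weight z
    <= expR (N%:R * w l * (2 * t ^+ 2) - y).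
Proof.
rewrite ler_norml => /andP[t_ge t_le].
(* From [expR (- t) >= 1 - t], since (1 + t + 2 t^2) (1 - t) >= 1 for t <= 1/2. *)
have expt : expR t - 1 - t <= 2 * t ^+ 2.
  have e1 : 1 - t <= expR (- t) by exact: expR_ge1Dx.
  have e2 : expR t * expR (- t) = 1 by rewrite -expRD subrr expR0.
  have e3 := expR_gt0 t.
  suff : expR t * (1 - t) <= (1 + t + 2 * t ^+ 2) * (1 - t).
    by rewrite ler_pM2r; lra.
  have -> : (1 + t + 2 * t ^+ 2) * (1 - t) = 1 + t ^+ 2 * (1 - 2 * t) by ring.
  apply: (@le_trans _ _ 1); first by rewrite -[leRHS]e2 ler_pM2l.
  by rewrite lerDl mulr_ge0 ?sqr_ge0//; lra.
apply: (@le_trans _ _ (\sum_(z : {ffun 'I_N -> V}) word_weight z *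
    expR (t * occ l z) * expR (- (t * N%:R * w l) - y))).
  rewrite big_mkcond; apply: ler_sum => z _; rewrite -mulrA -expRD.
  case: ifP => [yz|_]; last by rewrite mulr_ge0 ?word_weight_ge0 ?expR_ge0.
  rewrite ler_peMr ?word_weight_ge0// -[leLHS]expR0 ler_expR.
  by move: yz; lra.
rewrite -mulr_suml sum_expR_occ.
have -> : N%:R * w l * (2 * t ^+ 2) - y =
   N%:R * w l * (2 * t ^+ 2) + t * N%:R * w l + (- (t * N%:R * w l) - y) by ring.
rewrite [leRHS]expRD ler_wpM2r ?expR_ge0//.
have -> : N%:R * w l * (2 * t ^+ 2) + t * N%:R * w l
   = N%:R * (w l * (2 * t ^+ 2 + t)) by ring.
rewrite expRM_natl lerXn2r ?nnegrE ?expR_ge0//.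
  have := letter_prob_le1 l; have := w_ge0 l; have := expR_gt0 t; nra.
apply: (@le_trans _ _ (expR (w l * (expR t - 1)))); first exact: expR_ge1Dx.
by rewrite ler_expR ler_wpM2l//; lra.
Qed.

Lemma occ_upper_deviation N l (d : R) : 0 < d <= 2 ->
  \sum_(z : {ffun 'I_N -> V} | (1 + d) * (N%:R * w l) <= occ l z) word_weight z
    <= expR (- (N%:R * (w l * d ^+ 2 / 8))).
Proof.
move=> d01.
(* The exponent 2 t^2 - d t is least at t = d / 4. *)
have /(occ_chernoff N l (d ^+ 2 / 4 * (N%:R * w l))) : `|d / 4| <= 2^-1.
  by rewrite ger0_norm; lra.
have -> : N%:R * w l * (2 * (d / 4) ^+ 2) - d ^+ 2 / 4 * (N%:R * w l)
  = - (N%:R * (w l * d ^+ 2 / 8)) by field.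
apply: le_trans; apply: (ler_sum_subpred (@word_weight_ge0 _)) => z Hz.
have -> : d ^+ 2 / 4 * (N%:R * w l) = d / 4 * (d * (N%:R * w l)) by field.
by rewrite ler_pM2l; lra.
Qed.

Lemma occ_lower_deviation N l (d : R) : 0 < d <= 2 ->
  \sum_(z : {ffun 'I_N -> V} | occ l z <= (1 - d) * (N%:R * w l)) word_weight z
    <= expR (- (N%:R * (w l * d ^+ 2 / 8))).
Proof.
move=> d01; have /(occ_chernoff N l (d ^+ 2 / 4 * (N%:R * w l))) : `|- (d / 4)| <= 2^-1.
  by rewrite normrN ger0_norm; lra.
have -> : N%:R * w l * (2 * (- (d / 4)) ^+ 2) - d ^+ 2 / 4 * (N%:R * w l)
  = - (N%:R * (w l * d ^+ 2 / 8)) by field.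
apply: le_trans; apply: (ler_sum_subpred (@word_weight_ge0 _)) => z Hz.
have -> : - (d / 4) * (occ l z - N%:R * w l) = d / 4 * (N%:R * w l - occ l z) by ring.
have -> : d ^+ 2 / 4 * (N%:R * w l) = d / 4 * (d * (N%:R * w l)) by field.
by rewrite ler_pM2l; lra.
Qed.

(** * Smoothness of the tail *)

(** [letter_exchange] applied to the event that the sum is at least [u + (v be - v al)],
with both numbers of occurrences replaced by their means up to a factor [1 - d]
or [1 + d]; the exponentials pay for the words where this fails. *)
Lemma tail_shift_deviation N (al be : V) (d u : R) : (0 < N)%N -> 0 < d <= 2^-1 ->
  0 < w al -> 0 < w be ->
  (1 - d) * tail N u <= (1 + d) * tail N (u + (v be - v al)) +
    expR (- (N%:R * (w al * d ^+ 2 / 8)))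
    + expR (- (N%:R * (w be * d ^+ 2 / 8))) / w be.
Proof.
move=> N_gt0 d01 al_gt0 be_gt0.
have Nr : 0 < N%:R :> R by rewrite ltr0n.
have d2 : 0 < d <= 2 by lra.
set c := v be - v al.
have := letter_exchange N al be (fun x => (u + c <= x)%R%:R).
rewrite -/c.
under eq_bigr do rewrite lerD2r.
set L := \sum_z _; set U := \sum_z _ => LU.
have ltL : (1 - d) * (N%:R * w al) * (tail N u - expR (- (N%:R * (w al * d ^+ 2 / 8)))) <= L.
  apply: (@le_trans _ _ ((1 - d) * (N%:R * w al) * (tail N u -
    \sum_(z : {ffun 'I_N -> V} | occ al z <= (1 - d) * (N%:R * w al)) word_weight z))).
    rewrite ler_wpM2l//; first by rewrite mulr_ge0//; [lra|rewrite mulr_ge0// ltW].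
    by rewrite lerD2l lerN2 occ_lower_deviation.
  rewrite /tail !sum_word_weight_cond -sumrB mulr_sumr.
  apply: ler_sum => z _; have Wz := word_weight_ge0 z.
  have Oz := occ_ge0 al z; have X0 : 0 <= (1 - d) * (N%:R * w al).
    by rewrite mulr_ge0//; [lra|rewrite mulr_ge0// ltW].
  case: (u <= _); case: (lerP (occ al z) _) => O; rewrite ?mulr1 ?mulr0; nra.
have ltU : U <= (1 + d) * (N%:R * w be) * tail N (u + c) +
    N%:R * expR (- (N%:R * (w be * d ^+ 2 / 8))).
  apply: (@le_trans _ _ ((1 + d) * (N%:R * w be) * tail N (u + c) + N%:R *
    \sum_(z : {ffun 'I_N -> V} | (1 + d) * (N%:R * w be) <= occ be z) word_weight z)).
    rewrite /tail !sum_word_weight_cond !mulr_sumr -big_split.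
    apply: ler_sum => z _ /=; have Wz := word_weight_ge0 z.
    have Oz := occ_ge0 be z; have On := occ_le be z.
    have : 0 <= (1 + d) * (N%:R * w be).
      by rewrite mulr_ge0//; [lra|rewrite mulr_ge0// ltW].
    set X := (1 + d) * (N%:R * w be) => X0.
    case: (u + c <= _); case: (lerP _ (occ be z)) => O; rewrite ?mulr1 ?mulr0; nra.
  by rewrite lerD2l ler_wpM2l ?occ_upper_deviation// ltW.
have {LU ltL ltU} : w be * ((1 - d) * (N%:R * w al) * (tail N u - expR (- (N%:R * (w al * d ^+ 2 / 8)))))
  <= w al * ((1 + d) * (N%:R * w be) * tail N (u + c) +
    N%:R * expR (- (N%:R * (w be * d ^+ 2 / 8)))).
  apply: (@le_trans _ _ (w be * L)); first by rewrite ler_pM2l.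
  by rewrite LU ler_pM2l.
set F := tail N u; set G := tail N _; set x := expR _; set y := expR _ => H.
have x0 : 0 < x by exact: expR_gt0.
have {}H : w al * w be * N%:R * ((1 - d) * (F - x)) <=
       w al * w be * N%:R * ((1 + d) * G + y / w be).
  rewrite [leLHS](_ : _ = w be * ((1 - d) * (N%:R * w al) * (F - x))); last by ring.
  apply: (le_trans H); rewrite le_eqVlt; apply/orP; left; apply/eqP.
  by field; rewrite gt_eqF.
move: H; rewrite ler_pM2l ?mulr_gt0// => H.
nra.
Qed.

End IidLetters.

Lemma expR_decay (R : realType) (k C eps : R) : 0 < k -> 0 < C -> 0 < eps ->
  exists N0, forall N, (N0 <= N)%N -> C * expR (- (N%:R * k)) <= eps / N%:R.
Proof.
move=> k0 C0 e0; exists (Num.truncn (2 * C / (eps * k ^+ 2))).+1 => N HN.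
have N0 : 0 < N%:R :> R by rewrite ltr0n (leq_trans _ HN).
have : 2 * C / (eps * k ^+ 2) < N%:R.
  by apply: (lt_le_trans (truncnS_gt _)); rewrite ler_nat.
rewrite ltr_pdivrMr ?mulr_gt0 ?exprn_gt0// => HC.
rewrite expRN ler_pdivrMr ?expR_gt0// mulrAC ler_pdivlMr//.
have := @expR_ge1Dxn R (N%:R * k) 1 (ltW (mulr_gt0 N0 k0)).
rewrite (_ : 2`! = 2)%N// => He.
apply: (@le_trans _ _ (eps * ((N%:R * k) ^+ 2 / 2))); last first.
  by rewrite ler_pM2l//; lra.
have -> : eps * ((N%:R * k) ^+ 2 / 2) = N%:R * (eps * k ^+ 2) * N%:R / 2 by field.
by rewrite mulrAC ler_pM2r//; lra.
Qed.

(** The choice of [d] makes (1 + d) / (1 - d) at most [1 + eps].  As the bound is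
uniform in the alphabet, the alphabet may depend on [N]. *)
Lemma tail_shift_gap (R : realType) (pa pb c eps : R) :
  0 < pa -> 0 < pb -> 0 < eps ->
  exists N0, forall N, (N0 <= N)%N -> forall (V : finType) (w v : V -> R) (al be : V),
    (forall l, 0 <= w l) -> \sum_l w l = 1 -> w al = pa -> w be = pb ->
    v be - v al = c ->
    forall u, tail w v N u <= (1 + eps) * tail w v N (u + c) + eps / N%:R.
Proof.
move=> a0 b0 e0; pose d : R := Num.min eps 1 / 3.
have m0 : 0 < Num.min eps 1 by rewrite lt_min e0 /=.
have me : Num.min eps 1 <= eps by rewrite ge_min lexx.
have m1 : Num.min eps 1 <= 1 by rewrite ge_min lexx orbT.
have d0 : 0 < d <= 2^-1 by rewrite /d; apply/andP; split; lra.
have dpos : 0 < d by case/andP: d0.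
have e4 : 0 < eps / 4 by rewrite divr_gt0.
have kpos p : 0 < p -> 0 < p * d ^+ 2 / 8.
  by move=> p0; rewrite divr_gt0// mulr_gt0// exprn_gt0.
have [N1 H1] := expR_decay (kpos _ a0) ltr01 e4.
have ib0 : 0 < pb^-1 by rewrite invr_gt0.
have [N2 H2] := expR_decay (kpos _ b0) ib0 e4.
exists (maxn 1 (maxn N1 N2)) => N; rewrite !geq_max => /and3P[N0 /H1 {}H1 /H2 {}H2].
move=> V w v al be w0 w1 wa wb vc u.
have := @tail_shift_deviation R V w v w0 w1 N al be d u N0 d0.
rewrite wa wb vc => /(_ a0 b0).
move: H1 H2; rewrite mul1r [pb^-1 * _]mulrC.
have G0 := tail_ge0 v w0 N (u + c).
set x := expR _; set y := _ / pb; set F := tail _ _ _ u; set G := tail _ _ _ _ in G0 *.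
have Nr : 0 < N%:R^-1 :> R by rewrite invr_gt0 ltr0n.
move: Nr; set i := N%:R^-1 => i0 Hx Hy H.
have ei : 0 < eps * i by rewrite mulr_gt0.
have dd : 3 * d = Num.min eps 1 by rewrite /d; field.
suff : (1 - d) * F <= (1 - d) * ((1 + eps) * G + eps * i).
  by rewrite ler_pM2l//; lra.
apply: (le_trans H).
have : (1 + d) * G <= (1 - d) * (1 + eps) * G by rewrite ler_wpM2r//; nra.
have : 2^-1 * (eps * i) <= (1 - d) * (eps * i) by rewrite ler_pM2r//; lra.
lra.
Qed.

(** Iteration of [tail_shift_gap] until the multiples of the gap [c] exceed [L]. *)
Lemma tail_shift (R : realType) (pa pb c eps L : R) :
  0 < pa -> 0 < pb -> 0 < c -> 0 < eps ->
  exists N0, forall N, (N0 <= N)%N -> forall (V : finType) (w v : V -> R) (al be : V),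
    (forall l, 0 <= w l) -> \sum_l w l = 1 -> w al = pa -> w be = pb ->
    v be - v al = c ->
    forall u, tail w v N u <= (1 + eps) * tail w v N (u + L) + eps / N%:R.
Proof.
move=> a0 b0 c0.
have iter m : forall eps, 0 < eps -> exists N0, forall N, (N0 <= N)%N ->
    forall (V : finType) (w v : V -> R) (al be : V),
    (forall l, 0 <= w l) -> \sum_l w l = 1 -> w al = pa -> w be = pb ->
    v be - v al = c ->
    forall u, tail w v N u <= (1 + eps) * tail w v N (u + m%:R * c) + eps / N%:R.
  elim: m => [|m IH] e e0.
    exists 0%N => N _ V w v al be w0 _ _ _ _ u; rewrite mul0r addr0.
    have := tail_ge0 v w0 N u; have : 0 <= e / N%:R by rewrite divr_ge0// ltW.
    nra.
  pose d : R := Num.min e 1 / 3.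
  have m0 : 0 < Num.min e 1 by rewrite lt_min e0 /=.
  have me : Num.min e 1 <= e by rewrite ge_min lexx.
  have m1 : Num.min e 1 <= 1 by rewrite ge_min lexx orbT.
  have dd : 3 * d = Num.min e 1 by rewrite /d; field.
  have d0 : 0 < d by lra.
  have [N1 H1] := IH _ d0; have [N2 H2] := tail_shift_gap c a0 b0 d0.
  exists (maxn N1 N2) => N; rewrite geq_max => /andP[/H1 {}H1 /H2 {}H2].
  move=> V w v al be w0 w1 wa wb vc u.
  have {H1} := H1 V w v al be w0 w1 wa wb vc u.
  have {H2} := H2 V w v al be w0 w1 wa wb vc (u + m%:R * c).
  have -> : u + m%:R * c + c = u + m.+1%:R * c by rewrite -natr1; ring.
  have := tail_ge0 v w0 N (u + m.+1%:R * c).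
  set F := tail _ _ _ u; set G := tail _ _ _ (_ + m%:R * c).
  set K := tail _ _ _ _ => K0.
  have : 0 <= N%:R^-1 :> R by rewrite invr_ge0.
  set i := _^-1 => i0 HG HF.
  have : (1 + d) * G <= (1 + d) * ((1 + d) * K + d * i) by rewrite ler_pM2l//; lra.
  have : (1 + d) * (1 + d) * K <= (1 + e) * K by rewrite ler_wpM2r//; nra.
  have : (d * (1 + d) + d) * i <= e * i by rewrite ler_wpM2r//; nra.
  lra.
move=> e0; have [N0 H] := iter (Num.truncn (L / c)).+1 _ e0.
exists N0 => N /H {}H V w v al be w0 w1 wa wb vc u.
apply: (le_trans (H V w v al be w0 w1 wa wb vc u)).
rewrite lerD2r ler_pM2l ?addr_gt0//; apply: tail_le => //.
by rewrite lerD2l -ler_pdivrMr// ltW// truncnS_gt.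
Qed.

(** * Tournaments over a finite probability space *)

(** Chebyshev's inequality for the number of events [U i] that occur, which has
mean [m], at its value 0; [Q] bounds the correlations. *)
Lemma second_moment (R : realFieldType) (W I : finType) (pr : W -> R)
    (U : I -> pred W) (Q m : R) :
  (forall x, 0 <= pr x) -> \sum_x pr x = 1 -> 0 <= Q ->
  (forall i j, i != j -> \sum_(x | U i x && U j x) pr x <= Q) ->
  m = \sum_i \sum_(x | U i x) pr x ->
  m ^+ 2 * \sum_(x | [forall i, ~~ U i x]) pr x <= m + #|I|%:R ^+ 2 * Q - m ^+ 2.
Proof.
move=> pr0 pr1 Q0 UQ Em; pose cnt x : R := \sum_i (U i x)%:R.
have E1 : \sum_x pr x * cnt x = m.
  rewrite Em; under [RHS]eq_bigr do rewrite big_mkcond.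
  rewrite exchange_big; apply: eq_bigr => x _; rewrite mulr_sumr.
  by apply: eq_bigr => i _; case: ifP; rewrite ?mulr1 ?mulr0.
have E2 : \sum_x pr x * cnt x ^+ 2 <= m + #|I|%:R ^+ 2 * Q.
  have -> : \sum_x pr x * cnt x ^+ 2 = \sum_i \sum_j \sum_(x | U i x && U j x) pr x.
    under [RHS]eq_bigr => i _ do under eq_bigr => j _ do rewrite big_mkcond.
    under [RHS]eq_bigr => i _ do rewrite exchange_big.
    rewrite exchange_big; apply: eq_bigr => x _.
    rewrite expr2 mulr_suml mulr_sumr; apply: eq_bigr => i _.
    rewrite !mulr_sumr; apply: eq_bigr => j _.
    by case: (U i x); case: (U j x); rewrite ?(mulr1,mulr0,mul0r).
  have -> : m + #|I|%:R ^+ 2 * Q =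
      \sum_i (\sum_(x | U i x) pr x + \sum_(j : I) Q).
    rewrite big_split/= -Em !sumr_const -[in RHS]mulr_natl -[Q *+ _]mulr_natl.
    by rewrite expr2 mulrA.
  apply: ler_sum => i _; rewrite (bigD1 i)//= [in leRHS](bigD1 i)//=.
  rewrite lerD//; first by under eq_bigl do rewrite andbb.
  by rewrite ler_wpDl// ler_sum// => j ji; rewrite UQ// eq_sym.
have : m ^+ 2 * \sum_(x | [forall i, ~~ U i x]) pr x <= \sum_x pr x * (cnt x - m) ^+ 2.
  rewrite mulr_sumr big_mkcond; apply: ler_sum => x _; case: ifPn => [/forallP Ux|_].
    rewrite /cnt big1 => [|i _]; last by rewrite (negbTE (Ux i)).
    by rewrite sub0r sqrrN mulrC.
  by rewrite mulr_ge0// sqr_ge0.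
move=> /le_trans; apply.
have -> : \sum_x pr x * (cnt x - m) ^+ 2 =
   \sum_x pr x * cnt x ^+ 2 - m * 2 * (\sum_x pr x * cnt x) + m ^+ 2 * \sum_x pr x.
  rewrite !mulr_sumr -sumrN -!big_split/=; apply: eq_bigr => x _; ring.
rewrite E1 pr1; move: E2; rewrite !expr2; lra.
Qed.

(** The players other than [i] and [j], listed by ['I_N]; the default value is
reached only when [i = j]. *)
Definition others N (i j : 'I_N.+2) (k : 'I_N) : 'I_N.+2 :=
  lift i (lift (odflt ord0 (unlift i j)) k).

Lemma others_neql N (i j : 'I_N.+2) k : others i j k != i.
Proof. by rewrite eq_sym neq_lift. Qed.

Lemma others_neqr N (i j : 'I_N.+2) k : i != j -> others i j k != j.
Proof.
rewrite /others => ij; case: unliftP ij => [j' ->|->] /=; last by rewrite eqxx.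
by move=> _; rewrite (inj_eq lift_inj) eq_sym neq_lift.
Qed.

Lemma others_inj N (i j : 'I_N.+2) : injective (others i j).
Proof. by move=> k l /lift_inj/lift_inj. Qed.

Lemma sum_others (R : nmodType) N (i j : 'I_N.+2) (x : 'I_N.+2 -> R) : i != j ->
  \sum_(k | k != i) x k = x j + \sum_k x (others i j k).
Proof.
move=> ij; rewrite /others; case: unliftP ij => [j' ->|->] /=; last by rewrite eqxx.
move=> _; have -> : \sum_(k | k != i) x k = \sum_k x (lift i k).
  rewrite big_mkcond (bigD1_ord i)//= eqxx add0r; apply: eq_bigr => k _.
  by rewrite eq_sym neq_lift.
by rewrite (bigD1_ord j').
Qed.

Section FiniteTournament.
Context {R : realType} {V W : finType} (w v : V -> R) (N : nat).
Context (pr : W -> R) (zeta : W -> 'I_N.+2 -> 'I_N.+2 -> V).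

Definition row_sum x i : R := \sum_(j | j != i) v (zeta x i j).

(** The rewards of [i] against the players other than [i] and [j]: unlike the
full rows, [row_word x i j] and [row_word x j i] involve disjoint sets of games. *)
Definition row_word x i j : {ffun 'I_N -> V} := [ffun k => zeta x i (others i j k)].

Definition clear_winner x :=
  [exists i, forall (j | j != i), row_sum x j + 1 < row_sum x i].

Lemma row_sumE x i j : i != j ->
  row_sum x i = v (zeta x i j) + word_sum v (row_word x i j).
Proof.
move=> ij; rewrite /row_sum (sum_others _ ij); congr (_ + _).
by apply: eq_bigr => k _; rewrite ffunE.
Qed.

Context (w_ge0 : forall l, 0 <= w l) (w_sum1 : \sum_l w l = 1).
Context (v_01 : forall l, 0 <= v l <= 1).
Context (pr_ge0 : forall x, 0 <= pr x) (pr_sum1 : \sum_x pr x = 1).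
Context (row_words_indep : forall i j, i != j -> forall z z',
  \sum_(x | (row_word x i j == z) && (row_word x j i == z')) pr x
    = word_weight w z * word_weight w z').

Lemma row_word_sum_bounds x i j : i != j ->
  word_sum v (row_word x i j) <= row_sum x i <= word_sum v (row_word x i j) + 1.
Proof. by move=> ij; rewrite (row_sumE x ij); have := v_01 (zeta x i j); lra. Qed.

Lemma sum_row_words (E : {ffun 'I_N -> V} -> pred {ffun 'I_N -> V}) i j : i != j ->
  \sum_(x | E (row_word x i j) (row_word x j i)) pr x =
  \sum_z word_weight w z * \sum_(z' | E z z') word_weight w z'.
Proof.
move=> ij.
rewrite (partition_big (fun x => (row_word x i j, row_word x j i))
  (fun p => E p.1 p.2))//=.
under [RHS]eq_bigr do rewrite mulr_sumr.
rewrite (@pair_big_dep _ _ _ _ _ predT E)/=.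
apply: eq_bigr => -[z z'] /= Ezz'; rewrite -(row_words_indep ij); apply: eq_bigl => x.
rewrite xpair_eqE; case: eqP => [->|]; rewrite ?andbF//=.
by case: eqP => [->|]; rewrite ?andbF// Ezz'.
Qed.

Lemma prob_both_high_le i j (t : R) : i != j ->
  \sum_(x | (t <= row_sum x i) && (t <= row_sum x j)) pr x <= tail w v N (t - 1) ^+ 2.
Proof.
move=> ij; have ji : j != i by rewrite eq_sym.
apply: (@le_trans _ _ (\sum_(x | (t - 1 <= word_sum v (row_word x i j)) &&
   (t - 1 <= word_sum v (row_word x j i))) pr x)).
  apply: (ler_sum_subpred pr_ge0) => x; have := row_word_sum_bounds x ij.
  by have := row_word_sum_bounds x ji => /andP[_ ?] /andP[_ ?] /andP[? ?]; lra.
rewrite (sum_row_words (fun z z' => (t - 1 <= word_sum v z) && (t - 1 <= word_sum v z')))//.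
rewrite expr2 {1}/tail mulr_suml [leRHS]big_mkcond; apply: ler_sum => z _.
by case: (t - 1 <= _) => //=; rewrite big_pred0_eq mulr0.
Qed.

Lemma prob_high_ge i (t : R) : tail w v N t <= \sum_(x | t <= row_sum x i) pr x.
Proof.
have [j ij] : exists j, i != j by exists (lift i ord0); exact: neq_lift.
apply: (@le_trans _ _ (\sum_(x | t <= word_sum v (row_word x i j)) pr x)); last first.
  by apply: (ler_sum_subpred pr_ge0) => x; have /andP[? _] := row_word_sum_bounds x ij; lra.
rewrite (sum_row_words (fun z _ => t <= word_sum v z))//.
rewrite /tail big_mkcond; apply: ler_sum => z _.
case: (t <= _); first by rewrite sum_word_weight// mulr1.
by rewrite big_pred0_eq mulr0.
Qed.

Lemma tail_interval (u u' : R) : u <= u' ->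
  \sum_(z : {ffun 'I_N -> V} | u <= word_sum v z < u') word_weight w z
    = tail w v N u - tail w v N u'.
Proof.
move=> uu'; apply/eqP; rewrite eq_sym subr_eq; apply/eqP.
rewrite /tail (bigID (fun z => word_sum v z < u'))/=; congr (_ + _).
by apply: eq_bigl => z; rewrite -leNgt andb_idl// => ?; lra.
Qed.

(** Given the row word of [i], with sum [s >= t - 1], the sum for [j] lies in the
window from [s - 2] to [s + 3]; its probability is a difference of tails. *)
Lemma prob_near_tie_le i j (t g : R) : i != j ->
  (forall u, t - 3 <= u -> tail w v N u - tail w v N (u + 5) <= g) ->
  \sum_(x | [&& t <= row_sum x i, row_sum x j <= row_sum x i
      & row_sum x i <= row_sum x j + 1]) pr x <= tail w v N (t - 1) * g.
Proof.
move=> ij Hg; have ji : j != i by rewrite eq_sym.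
pose E (z z' : {ffun 'I_N -> V}) := (t - 1 <= word_sum v z) &&
  (word_sum v z - 2 <= word_sum v z' < word_sum v z - 2 + 5).
apply: (@le_trans _ _ (\sum_(x | E (row_word x i j) (row_word x j i)) pr x)).
  apply: (ler_sum_subpred pr_ge0) => x; have := row_word_sum_bounds x ij.
  have := row_word_sum_bounds x ji; rewrite /E.
  by move=> /andP[? ?] /andP[? ?] /and3P[? ? ?]; apply/and3P; split; lra.
rewrite sum_row_words// /tail mulr_suml [leRHS]big_mkcond; apply: ler_sum => z _.
rewrite /E; case: ifPn => [tz|]; last by rewrite big_pred0_eq mulr0.
rewrite ler_wpM2l ?word_weight_ge0//= tail_interval; last by lra.
by apply: Hg; lra.
Qed.

(** Unless everybody is below [t], a player with the largest sum reaches [t], and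
if the lead is not clear some other player is within distance 1. *)
Lemma prob_no_clear_winner_le (t : R) :
  \sum_(x | ~~ clear_winner x) pr x <=
  \sum_(x | [forall i, ~~ (t <= row_sum x i)]) pr x +
  \sum_i \sum_(j | i != j) \sum_(x | [&& t <= row_sum x i, row_sum x j <= row_sum x i
      & row_sum x i <= row_sum x j + 1]) pr x.
Proof.
rewrite big_mkcond [X in _ <= X + _]big_mkcond.
under [in X in _ <= _ + X]eq_bigr => i _ do under eq_bigr => j _ do rewrite big_mkcond.
under [in X in _ <= _ + X]eq_bigr => i _ do rewrite exchange_big.
rewrite [in X in _ <= _ + X]exchange_big -big_split/=; apply: ler_sum => x _.
set T := fun i j => [&& t <= row_sum x i, row_sum x j <= row_sum x i
      & row_sum x i <= row_sum x j + 1].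
have S0 i : 0 <= \sum_(j | i != j) (if T i j then pr x else 0).
  by apply: sumr_ge0 => j _; case: ifP.
have A0 : 0 <= (if [forall i, ~~ (t <= row_sum x i)] then pr x else 0) by case: ifP.
have B0 : 0 <= \sum_i \sum_(j | i != j) (if T i j then pr x else 0) by exact: sumr_ge0.
case: ifPn => [nc|_]; last by rewrite addr_ge0.
have [|/forallPn[k]] := boolP [forall i, ~~ (t <= row_sum x i)].
  by rewrite lerDl.
rewrite negbK add0r => tk.
have [i _ imax] := arg_maxP (row_sum x) (erefl : predT k).
have := nc; rewrite negb_exists => /forallP/(_ i)/forall_inPn[j ji].
rewrite -leNgt => ij.
rewrite (bigD1 i)//= (bigD1 j) 1?eq_sym//=.
rewrite -/(T i j); have -> : T i j.
  by apply/and3P; split=> //; [apply: le_trans tk _|]; exact: imax.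
rewrite -addrA lerDl addr_ge0// sumr_ge0// => l _; case: ifP => //.
Qed.

End FiniteTournament.

Lemma tail0 (R : realType) (V : finType) (w v : V -> R) N :
  (forall l, 0 <= w l) -> \sum_l w l = 1 -> (forall l, 0 <= v l <= 1) ->
  tail w v N 0 = 1.
Proof.
move=> w0 w1 v01; rewrite -(sum_word_weight w1 N); apply: eq_bigl => z.
by apply: sumr_ge0 => k _; case/andP: (v01 (z k)).
Qed.

Lemma tail_beyond_max (R : realType) (V : finType) (w v : V -> R) N :
  (forall l, 0 <= v l <= 1) -> tail w v N N.+1%:R = 0.
Proof.
move=> v01; apply: big_pred0 => z; apply/negbTE; rewrite -ltNge.
apply: (@le_lt_trans _ _ N%:R); last by rewrite ltr_nat.
rewrite -[in leRHS](card_ord N) -sum1_card natr_sum; apply: ler_sum => k _.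
by case/andP: (v01 (z k)).
Qed.

(** Integer steps suffice: the tail is 1 at 0 and vanishes at [N + 1]. *)
Lemma tail_crossing (R : realType) (V : finType) (w v : V -> R) N (q : R) :
  (forall l, 0 <= w l) -> \sum_l w l = 1 -> (forall l, 0 <= v l <= 1) ->
  0 < q <= 1 ->
  exists t, q <= tail w v N t /\ tail w v N (t + 1) < q.
Proof.
move=> w0 w1 v01 /andP[q0 q1].
have ex : exists n, q <= tail w v N n%:R by exists 0%N; rewrite tail0.
have bd n : q <= tail w v N n%:R -> (n <= N)%N.
  move=> qn; rewrite leqNgt; apply/negP => Nn; move: qn; rewrite leNgt => /negP; apply.
  apply: le_lt_trans q0; rewrite -(tail_beyond_max w N v01); apply: tail_le => //.
  by rewrite ler_nat.
case: (ex_maxnP ex bd) => n qn nmax; exists n%:R; split => //.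
by rewrite natr1 ltNge; apply/negP => /nmax; rewrite ltnn.
Qed.

(** The expected number of players above the threshold is at least [K], so that
nobody reaches it with probability at most [1 / K + 8 d]; the factor
[9 (2 K + 1) (K + 1) d] bounds the probability of a near tie. *)
Lemma clear_winner_whp (R : realType) (pa pb c eps : R) :
  0 < pa -> 0 < pb -> 0 < c -> 0 < eps ->
  exists N0, forall N, (N0 <= N)%N ->
  forall (V W : finType) (w v : V -> R) (al be : V) (pr : W -> R)
    (zeta : W -> 'I_N.+2 -> 'I_N.+2 -> V),
    (forall l, 0 <= w l) -> \sum_l w l = 1 -> (forall l, 0 <= v l <= 1) ->
    w al = pa -> w be = pb -> v be - v al = c ->
    (forall x, 0 <= pr x) -> \sum_x pr x = 1 ->
    (forall i j, i != j -> forall z z',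
      \sum_(x | (row_word zeta x i j == z) && (row_word zeta x j i == z')) pr x
        = word_weight w z * word_weight w z') ->
  1 - eps <= \sum_(x | clear_winner v zeta x) pr x.
Proof.
move=> a0 b0 c0 eps0.
have [e [e0 e_eps e1]] : exists e : R, [/\ 0 < e, e <= eps & e <= 1].
  by exists (Num.min eps 1); rewrite lt_min eps0 !ge_min !lexx orbT/=.
have [K [KV K4]] : exists K : R, K^-1 = e / 4 /\ 4 <= K.
  by exists (4 / e); rewrite invf_div ler_pdivlMr//; split=> //; lra.
have [M ME] : exists M : R, M = 9 * (2 * K + 1) * (K + 1) by eexists.
have M32 : 32 <= M by rewrite ME; nra.
have [d [d0 dM]] : exists d : R, 0 < d /\ M * d = e / 4.
  exists (e / (4 * M)); split; first by rewrite divr_gt0//; lra.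
  by field; rewrite gt_eqF//; lra.
have d8 : 8 * d <= e / 4 by nra.
have [N1 shift] := tail_shift 5 a0 b0 c0 d0.
exists (maxn N1 (Num.truncn K).+1) => N; rewrite geq_max => /andP[/shift{}shift KN].
have {}KN : K < N%:R by apply: (lt_le_trans (truncnS_gt _)); rewrite ler_nat.
have N0 : 0 < N%:R :> R by lra.
move=> V W w v al be pr zeta w0 w1 v01 wa wb vc pr0 pr1 indep.
have [q Ki] : exists q, K * N%:R^-1 = q by eexists.
have q01 : 0 < q <= 1.
  by rewrite -Ki divr_gt0//=; [rewrite ler_pdivrMr// mul1r ltW | lra].
have [t [qt tq]] := tail_crossing N w0 w1 v01 q01.
have {}shift := shift V w v al be w0 w1 wa wb vc.
have i_pos : 0 < N%:R^-1 :> R by rewrite invr_gt0.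
have iq : N%:R^-1 <= q by rewrite -Ki ler_peMl ?ltW//; lra.
have F5 u : t - 4 <= u -> tail w v N (u + 5) < q.
  by move=> tu; apply: le_lt_trans tq; apply: tail_le => //; lra.
have gap u : t - 3 <= u -> tail w v N u - tail w v N (u + 5) <= d * (K + 1) * N%:R^-1.
  move=> tu; have u4 : t - 4 <= u by lra.
  have := shift u; have := F5 u u4; move: Ki; nra.
have F1 : tail w v N (t - 1) <= (2 * K + 1) * N%:R^-1.
  have t4 : t - 4 <= t - 1 by lra.
  have := shift (t - 1); have := F5 _ t4; move: Ki; nra.
have F2 : tail w v N (t - 1) <= (1 + 2 * d) * tail w v N t.
  have : tail w v N (t - 1 + 5) <= tail w v N t by apply: tail_le => //; lra.
  have := shift (t - 1); have := qt; move: iq; nra.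
have n3 : N.+2%:R <= 3 * N%:R :> R by rewrite -[N.+2]addn2 natrD; lra.
have f0 : 0 <= tail w v N (t - 1) by exact: tail_ge0.
(* Each of the at most (3 N)^2 pairs contributes at most F(t - 1) times [gap]. *)
have ties : \sum_i \sum_(j | i != j) \sum_(x | [&& t <= row_sum v zeta x i,
      row_sum v zeta x j <= row_sum v zeta x i
      & row_sum v zeta x i <= row_sum v zeta x j + 1]) pr x <= e / 4.
  apply: (@le_trans _ _ (\sum_(i < N.+2) \sum_(j < N.+2)
      tail w v N (t - 1) * (d * (K + 1) * N%:R^-1))).
    apply: ler_sum => i _; rewrite big_mkcond; apply: ler_sum => j _.
    case: ifPn => ij; first exact: (prob_near_tie_le w0 v01 pr0 indep ij gap).
    by rewrite !mulr_ge0//; lra.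
  rewrite !sumr_const !card_ord -mulrnA -[leLHS]mulr_natl natrM -expr2.
  apply: (@le_trans _ _ ((3 * N%:R) ^+ 2 * ((2 * K + 1) * N%:R^-1 * (d * (K + 1) * N%:R^-1)))).
    apply: ler_pM; rewrite ?sqr_ge0//; first by rewrite !mulr_ge0//; lra.
      by rewrite lerXn2r ?nnegrE// ?mulr_ge0//; lra.
    by rewrite ler_wpM2r// !mulr_ge0//; lra.
  have <- : M * d = (3 * N%:R) ^+ 2 * ((2 * K + 1) * N%:R^-1 * (d * (K + 1) * N%:R^-1)).
    by rewrite ME; field; rewrite gt_eqF.
  by rewrite dM.
(* At most 1 / K + ((1 + 2 d)^2 - 1), by the second moment method. *)
have empty : \sum_(x | [forall i, ~~ (t <= row_sum v zeta x i)]) pr x <= e / 2.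
  have Q0 : 0 <= tail w v N (t - 1) ^+ 2 by exact: sqr_ge0.
  have := @second_moment R W 'I_N.+2 pr (fun i x => t <= row_sum v zeta x i) _ _ pr0 pr1 Q0
    (fun i j ij => prob_both_high_le v01 pr0 indep t ij) erefl.
  rewrite /= card_ord; set m := \sum_i _; set p0 := (\sum_(x | _) _).
  have mF : N.+2%:R * tail w v N t <= m.
    rewrite mulr_natl -[in leLHS](card_ord N.+2) -sumr_const; apply: ler_sum => i _.
    exact: (prob_high_ge w1 v01 pr0 indep).
  have mK : K <= m.
    apply: le_trans mF; apply: (@le_trans _ _ (N%:R * q)).
      by rewrite -Ki mulrC divfK// gt_eqF.
    by rewrite ler_pM ?ler_nat// ?(leqW (leqnSn N))// ltW//; case/andP: q01.
  have m0 : 0 < m by lra.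
  have step : N.+2%:R ^+ 2 * tail w v N (t - 1) ^+ 2 <= (1 + 2 * d) ^+ 2 * m ^+ 2.
    rewrite -!exprMn lerXn2r ?nnegrE ?mulr_ge0//; try lra.
    apply: (@le_trans _ _ (N.+2%:R * ((1 + 2 * d) * tail w v N t))).
      by rewrite ler_wpM2l.
    by rewrite mulrCA ler_wpM2l//; lra.
  move=> H; have {step}H : m ^+ 2 * p0 <= m ^+ 2 * (m^-1 + ((1 + 2 * d) ^+ 2 - 1)).
    have -> : m ^+ 2 * (m^-1 + ((1 + 2 * d) ^+ 2 - 1)) = m + (1 + 2 * d) ^+ 2 * m ^+ 2 - m ^+ 2.
      by field; rewrite gt_eqF.
    lra.
  move: H; rewrite ler_pM2l ?exprn_gt0// => /le_trans; apply.
  have : m^-1 <= e / 4.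
    by rewrite -KV lef_pV2 ?posrE//; lra.
  have : (1 + 2 * d) ^+ 2 - 1 <= 8 * d by rewrite expr2; nra.
  lra.
have := @prob_no_clear_winner_le R V W v N pr zeta pr0 t.
have := pr1; rewrite (bigID (clear_winner v zeta))/=; lra.
Qed.

(** * Reduction to a finite probability space *)

Lemma measurable_finite_valued d (T : measurableType d) (W : finType) (Z : T -> W) :
  (forall x, measurable (Z @^-1` [set x])) ->
  forall A : pred W, measurable [set t | A (Z t)].
Proof.
move=> mZ A; rewrite (_ : [set t | _] = \bigcup_(x in [set x | A x]) Z @^-1` [set x]).
  by apply: fin_bigcup_measurable => //; exact: finite_finset.
apply/seteqP; split=> t /=; first by exists (Z t).
by move=> [x Ax Ztx]; rewrite Ztx.
Qed.

Lemma probability_finite_valued (R : realType) d (T : measurableType d)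
    (P : probability T R) (W : finType) (Z : T -> W) :
  (forall x, measurable (Z @^-1` [set x])) ->
  forall A : pred W,
  P [set t | A (Z t)] = (\sum_(x | A x) fine (P (Z @^-1` [set x])))%:E.
Proof.
move=> mZ A; have mA := measurable_finite_valued mZ.
have claim s : uniq s ->
    P [set t | (Z t \in s) && A (Z t)] = (\sum_(x <- s | A x) fine (P (Z @^-1` [set x])))%:E.
  elim: s => [|x s IH] /=.
    by move=> _; rewrite big_nil (_ : [set t | _] = set0) ?measure0//; apply/seteqP; split.
  move=> /andP[xs us]; rewrite big_cons.
  have -> : [set t | (Z t \in x :: s) && A (Z t)] =
      [set t | (Z t == x) && A (Z t)] `|` [set t | (Z t \in s) && A (Z t)].
    by apply/seteqP; split=> t /=; rewrite inE andb_orl => /orP.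
  rewrite measureU; [|exact: (mA (fun y => (y == x) && A y))|
    exact: (mA (fun y => (y \in s) && A y))|]; last first.
    apply/seteqP; split=> // t [/= /andP[/eqP -> _] /andP[]]; by rewrite (negbTE xs).
  rewrite [X in (_ + X)%E](IH us); case: ifPn => Ax.
    rewrite EFinD fineK ?fin_num_measure//; congr (P _ + _)%E.
    apply/seteqP; split=> t /=; first by case/andP => /eqP.
    by move=> ->; rewrite eqxx.
  rewrite (_ : [set t | (Z t == x) && A (Z t)] = set0) ?measure0 ?add0e//.
  by apply/seteqP; split=> // t /= /andP[/eqP ->]; rewrite (negbTE Ax).
have := claim _ (index_enum_uniq W).
by rewrite (_ : [set t | _] = [set t | A (Z t)])//; apply/seteqP; split=> t /=;
  rewrite mem_index_enum.
Qed.

(** Rewards taken from distinct games, one side of each game, are independent: the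
second hypothesis on [e] says that no two of them belong to the same game. *)
Lemma oriented_independence (R : realType) (D : set R) (mu : probability R R)
    n d (T : measurableType d) (P : probability T R)
    (X : 'I_n -> 'I_n -> {RV P >-> R}) (I : finType) (e : I -> 'I_n * 'I_n)
    (C : I -> set R) :
  model01 D mu X -> (forall s, (e s).1 != (e s).2) ->
  (forall s s', e s = e s' \/ e s = ((e s').2, (e s').1) -> s = s') ->
  (forall s, measurable (C s)) ->
  P [set t | forall s, C s (X (e s).1 (e s).2 t)] = (\prod_s mu (C s))%E.
Proof.
move=> [indep _ _ law] e_neq e_inj mC.
pose up s := ((e s).1 < (e s).2)%N.
have /choice[G GE] : forall s, exists g : game n,
    val g = if up s then e s else ((e s).2, (e s).1).
  move=> s; rewrite /up; case: ifPn => lt; first by exists (Sub (e s) lt).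
  have lt' : (((e s).2, (e s).1).1 < ((e s).2, (e s).1).2)%N.
    by rewrite /= ltn_neqAle eq_sym (inj_eq val_inj) e_neq leqNgt.
  by exists (Sub ((e s).2, (e s).1) lt').
have G_inj : injective G.
  move=> s s' /(congr1 val); rewrite !GE; case: (up s); case: (up s') => E;
    apply: e_inj; move: E; case: (e s) => a b; case: (e s') => a' b' /= [-> ->]; by [left|right].
pose C' s : set (R * R) := if up s then C s `*` setT else setT `*` C s.
have mC' s : measurable (C' s) by rewrite /C'; case: ifP => _; exact: measurableX.
have C'E s : game_rewards (fun i j => X i j) (G s) @^-1` C' s =
    X (e s).1 (e s).2 @^-1` C s.
  rewrite /C' /game_rewards GE; case: ifP => _; apply/seteqP; split=> t //=; by case.
pose B g : set (R * R) := if [pick s | G s == g] is Some s then C' s else setT.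
have BG s : B (G s) = C' s.
  rewrite /B; case: pickP => [s' /eqP/G_inj -> //|/(_ s)]; by rewrite eqxx.
have mB g : g \in [set G s | s in I]%SET -> measurable (B g).
  by move=> _; rewrite /B; case: pickP.
have := indep _ _ mB; rewrite big_imset/= => [|s s' _ _ /G_inj//].
rewrite [in RHS](eq_bigl predT)// => E.
transitivity (P (\bigcap_(k in [set` [set G s | s in I]%SET])
    (game_rewards (fun i j => X i j) k @^-1` B k))).
  congr (P _); apply/seteqP; split=> t /=.
    move=> H _ /= /imsetP[s _ ->]; rewrite BG.
    by rewrite -[C' s _]/((game_rewards (fun i j => X i j) (G s) @^-1` C' s) t) C'E; exact: H.
  move=> H s; have := H (G s) (imset_f _ isT); by rewrite BG C'E.
rewrite E; apply: eq_bigr => s _; rewrite BG C'E.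
exact: (law _ _ (e_neq s) _ (mC s)).
Qed.

(** Besides the grid cell of mesh [1 / M], a letter records exactly whether the
reward is [a] or [b]: these two must keep their masses for [tail_shift]. *)
Definition letter (R : realType) (a b : R) M (x : R) : option (option 'I_M.+1) :=
  if x == a then None else if x == b then Some None
  else Some (Some (inord (Num.truncn (M%:R * x)))).

Definition letter_value (R : realType) (a b : R) M (l : option (option 'I_M.+1)) : R :=
  match l with
  | None => a
  | Some None => b
  | Some (Some k) => k%:R / M%:R
  end.

Lemma letter_value_01 (R : realType) (a b : R) M (l : option (option 'I_M.+1)) :
  0 <= a <= 1 -> 0 <= b <= 1 -> 0 <= letter_value a b l <= 1.
Proof.
move=> a01 b01; case: l => [[k|]|]//=; rewrite divr_ge0//=.
have := ltn_ord k; rewrite ltnS; move: (nat_of_ord k) => m mM.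
have [->|M0] := posnP M; first by rewrite invr0 mulr0.
by rewrite ler_pdivrMr ?ltr0n// mul1r ler_nat.
Qed.

Lemma letter_value_bounds (R : realType) (a b : R) M (x : R) : (0 < M)%N -> 0 <= x <= 1 ->
  letter_value a b (letter a b M x) <= x <= letter_value a b (letter a b M x) + M%:R^-1.
Proof.
move=> M0 /andP[x0 x1]; have Mr : 0 < M%:R :> R by rewrite ltr0n.
have i0 : 0 < M%:R^-1 :> R by rewrite invr_gt0.
rewrite /letter; case: eqP => [->|_] /=; first by rewrite lexx lerDl ltW.
case: eqP => [->|_] /=; first by rewrite lexx lerDl ltW.
have Mx0 : 0 <= M%:R * x by rewrite mulr_ge0// ltW.
have /andP[lo hi] := truncn_itv Mx0.
have kM : (Num.truncn (M%:R * x) < M.+1)%N.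
  rewrite ltnS -(ler_nat R); apply: le_trans lo _.
  by rewrite ler_piMr// ltW.
rewrite inordK// ler_pdivrMr// [x * _]mulrC lo/=.
by rewrite -{2}[M%:R^-1]mul1r -mulrDl ler_pdivlMr// natr1 [x * _]mulrC ltW.
Qed.

Lemma measurable_letter (R : realType) (a b : R) M l :
  measurable (letter a b M @^-1` [set l]).
Proof.
have trunc_measurable (Q : pred nat) : measurable [set x : R | Q (Num.truncn (M%:R * x))].
  pose f (x : R) : R := (Num.truncn (M%:R * x))%:R.
  have f_mono : {homo f : x y / x <= y}.
    by move=> x y xy; rewrite ler_nat le_truncn// ler_wpM2l.
  have mf := @nondecreasing_measurable R setT f measurableT f_mono.
  have cQ : measurable [set (k%:R : R) | k in [set k | Q k]].
    apply: countable_measurable; first exact: measurable_set1.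
    exact: sub_countable (card_image_le _ _) (countableP _).
  have := mf measurableT _ cQ; rewrite setTI.
  rewrite (_ : f @^-1` _ = [set x : R | Q (Num.truncn (M%:R * x))])//.
  apply/seteqP; split=> x /=; last by exists (Num.truncn (M%:R * x)).
  by move=> [k Qk] /eqP; rewrite eqr_nat => /eqP <-.
case: l => [[k|]|].
- rewrite (_ : _ @^-1` _ = (~` [set a] `&` ~` [set b]) `&`
     [set x | inord (Num.truncn (M%:R * x)) == k :> 'I_M.+1]).
    apply: measurableI; last exact: (trunc_measurable (fun m => inord m == k :> 'I_M.+1)).
    by apply: measurableI; apply: measurableC; exact: measurable_set1.
  apply/seteqP; split=> x /=; rewrite /letter.
    by case: eqP => // xa; case: eqP => // xb [->].
  by move=> [[/eqP/negbTE -> /eqP/negbTE ->] /eqP ->].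
- rewrite (_ : _ @^-1` _ = ~` [set a] `&` [set b]).
    by apply: measurableI; [apply: measurableC|]; exact: measurable_set1.
  apply/seteqP; split=> x /=; rewrite /letter.
    by case: eqP => // xa; case: eqP.
  by move=> [/eqP/negbTE -> ->]; rewrite eqxx.
- rewrite (_ : _ @^-1` _ = [set a]); first exact: measurable_set1.
  apply/seteqP; split=> x /=; rewrite /letter; last by move=> ->; rewrite eqxx.
  by case: eqP => //; case: eqP.
Qed.

Lemma unique_winnerE (R : realType) n (T : Type) (X : 'I_n -> 'I_n -> T -> R) :
  unique_winner X = \bigcup_(i in [set: 'I_n]) \bigcap_(j in [set j | j != i])
    [set t | score X j t < score X i t].
Proof.
apply/seteqP; split=> t.
  move=> [i [imax uniq]]; exists i => // j /= ji.
  rewrite lt_neqAle imax andbT; apply: contra_neq ji => sj.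
  by apply: esym; apply: uniq => k; rewrite sj; exact: imax.
move=> [i _ lt_i]; exists i; split=> [j|j jmax].
  have [->//|ji] := eqVneq j i; apply: ltW; exact: lt_i.
have [->//|ji] := eqVneq j i.
by have := lt_i j ji; rewrite /= ltNge (jmax i).
Qed.

Lemma measurable_unique_winner (R : realType) n d (T : measurableType d)
    (P : probability T R) (X : 'I_n -> 'I_n -> {RV P >-> R}) :
  measurable (unique_winner (fun i j => X i j)).
Proof.
have ms i : measurable_fun setT (score (fun i j => X i j) i).
  rewrite /score; under eq_fun do rewrite big_mkcond.
  by apply: measurable_sum => j; case: (j != i); [exact: measurable_funPT|exact: measurable_cst].
rewrite unique_winnerE; apply: fin_bigcup_measurable => // i _.
apply: fin_bigcap_measurable => [|j _]; first exact: finite_finset.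
have mtrue : measurable [set true] by [].
have := measurable_fun_ltr (ms j) (ms i) measurableT mtrue.
rewrite setTI.
by rewrite (_ : _ @^-1` _ = [set t | score (fun i j => X i j) j t < score (fun i j => X i j) i t]).
Qed.

(** Rounding loses at most [1 / (N + 1)] in each of [N + 1] games. *)
Lemma row_sum_score (R : realType) N (a b : R) (T : Type)
    (X : 'I_N.+2 -> 'I_N.+2 -> T -> R) (t : T) (i : 'I_N.+2) :
  (forall i j, i != j -> 0 <= X i j t <= 1) ->
  let s := \sum_(j | j != i) letter_value a b (letter a b N.+1 (X i j t)) in
  s <= score X i t <= s + 1.
Proof.
move=> X01 /=; rewrite /score.
have bounds j : j != i -> letter_value a b (letter a b N.+1 (X i j t)) <= X i j t
    <= letter_value a b (letter a b N.+1 (X i j t)) + N.+1%:R^-1.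
  by rewrite eq_sym => ij; apply: letter_value_bounds => //; exact: X01.
apply/andP; split; first by apply: ler_sum => j /bounds/andP[].
apply: (@le_trans _ _ (\sum_(j | j != i)
    (letter_value a b (letter a b N.+1 (X i j t)) + N.+1%:R^-1))).
  by apply: ler_sum => j /bounds/andP[].
rewrite big_split/= lerD2l sumr_const cardC1 card_ord -[leLHS]mulr_natl divff//.
by rewrite pnatr_eq0.
Qed.

(** The finite space consists of the tables of letters of all ordered pairs of
players, with their joint law.  Rewards leave [0, 1] with probability zero;
elsewhere, by [row_sum_score], a clear winner among the rounded scores is the
unique winner. *)
Lemma discretization (R : realType) (D : set R) (mu : probability R R) N
    d (T : measurableType d) (P : probability T R)
    (X : 'I_N.+2 -> 'I_N.+2 -> {RV P >-> R}) (a b : R) :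
  D `<=` `[0, 1] -> model01 D mu X ->
  let w l := fine (mu (letter a b N.+1 @^-1` [set l])) in
  let v := @letter_value R a b N.+1 in
  exists (W : finType) (pr : W -> R)
    (zeta : W -> 'I_N.+2 -> 'I_N.+2 -> option (option 'I_N.+2)),
  [/\ forall x, 0 <= pr x, \sum_x pr x = 1,
      forall i j, i != j -> forall z z',
        \sum_(x | (row_word zeta x i j == z) && (row_word zeta x j i == z')) pr x
          = word_weight w z * word_weight w z' &
      ((\sum_(x | clear_winner v zeta x) pr x)%:E
        <= P (unique_winner (fun i j => X i j)))%E].
Proof.
move=> D01 hX w v.
pose W := {ffun 'I_N.+2 * 'I_N.+2 -> option (option 'I_N.+2)}.
pose Z (t : T) : W := [ffun p => letter a b N.+1 (X p.1 p.2 t)].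
have mZ x : measurable (Z @^-1` [set x]).
  rewrite (_ : _ @^-1` _ = \bigcap_(p in setT)
      (X p.1 p.2 @^-1` (letter a b N.+1 @^-1` [set x p]))).
    apply: fin_bigcap_measurable => [|p _]; first exact: finite_finset.
    by rewrite -[X in measurable X]setTI; apply: measurable_funPT => //; exact: measurable_letter.
  apply/seteqP; split=> t /=; first by move=> <- p _ /=; rewrite ffunE.
  by move=> H; apply/ffunP => p; rewrite ffunE; exact: H.
pose zeta (x : W) i j := x (i, j).
exists W, (fun x => fine (P (Z @^-1` [set x]))), zeta.
have PZ := probability_finite_valued P mZ.
split=> [x||i j ij z z'|].
- exact/fine_ge0/measure_ge0.
- apply/EFin_inj; rewrite -(PZ predT) -(probability_setT P); congr (P _).
  by apply/seteqP; split.
- apply/EFin_inj; rewrite -(PZ (fun x => (row_word zeta x i j == z) && (row_word zeta x j i == z'))).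
  have ji : j != i by rewrite eq_sym.
  pose e (s : 'I_N + 'I_N) := match s with
    | inl k => (i, others i j k) | inr k => (j, others j i k) end.
  pose C (s : 'I_N + 'I_N) : set R := match s with
    | inl k => letter a b N.+1 @^-1` [set z k]
    | inr k => letter a b N.+1 @^-1` [set z' k] end.
  have e_neq s : (e s).1 != (e s).2.
    by case: s => k /=; rewrite eq_sym others_neql.
  have e_inj s s' : e s = e s' \/ e s = ((e s').2, (e s').1) -> s = s'.
    case: s => k; case: s' => k' /= [] /pair_equal_spec[E1 E2].
    + by rewrite (others_inj E2).
    + by have := others_neql i j k'; rewrite -E1 eqxx.
    + by rewrite E1 eqxx in ij.
    + by have := others_neqr k ij; rewrite E2 eqxx.
    + by rewrite E1 eqxx in ij.
    + by have := others_neqr k ji; rewrite E2 eqxx.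
    + by rewrite (others_inj E2).
    + by have := others_neql j i k'; rewrite -E1 eqxx.
  have mC s : measurable (C s) by case: s => k; exact: measurable_letter.
  have := oriented_independence hX e_neq e_inj mC.
  rewrite big_sumType/= => E.
  transitivity (P [set t | forall s, C s (X (e s).1 (e s).2 t)]).
    congr (P _); apply/seteqP; split=> t /=.
      by move=> /andP[/eqP Ez /eqP Ez'] [k|k] /=; rewrite -?Ez -?Ez' !ffunE /zeta ffunE.
    move=> H; apply/andP; split; apply/eqP/ffunP => k; rewrite !ffunE /zeta ffunE.
      exact: (H (inl k)).
    exact: (H (inr k)).
  rewrite E /word_weight EFinM -!prodEFin; congr (_ * _)%E;
    by apply: eq_bigr => k _; rewrite fineK// fin_num_measure//; exact: measurable_letter.
- rewrite -(PZ (clear_winner v zeta)).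
  have mU := measurable_unique_winner X.
  have mW := measurable_finite_valued mZ (clear_winner v zeta).
  have : \forall t \ae P, forall i j, i != j -> D (X i j t).
    apply: filter_forall => i; apply: filter_forall => j.
    have [ij|ij] := boolP (i != j); last by apply: filterE.
    by apply: filterS (model01_val hX ij).
  move=> [B [mB PB sB]].
  apply: (@le_trans _ _ (P (unique_winner (fun i j => X i j) `|` B))); last first.
    apply: (le_trans (measureU2 _ mU mB)).
    by rewrite [X in (_ + X)%E]PB adde0.
  apply: le_measure; rewrite ?inE//; first exact: measurableU.
  move=> t /= /existsP[i /forall_inP iwin].
  have [/= all_D|nD] := pselect (forall i j, i != j -> D (X i j t)); last first.
    by right; apply: sB.
  left; rewrite unique_winnerE; exists i => // j /= ji.
  have X01 k l : k != l -> 0 <= X k l t <= 1.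
    by move=> /all_D /D01 /=; rewrite in_itv.
  have rowE k : row_sum v zeta (Z t) k =
      \sum_(l | l != k) v (letter a b N.+1 (X k l t)).
    by apply: eq_bigr => l _; rewrite /zeta ffunE.
  have := iwin _ ji; rewrite !rowE.
  have row := @row_sum_score R N a b T (fun i j => X i j) t _ X01.
  have := row i; have := row j.
  move=> /= /andP[_ +] /andP[+ _]; rewrite -/v; lra.
Qed.

Theorem mainTheorem1 (R : realType) (D : set R) (mu : probability R R)
    (hD : score_set D mu)
    (d : nat -> measure_display) (T : forall n : nat, measurableType (d n))
    (P : forall n : nat, probability (T n) R)
    (X : forall n : nat, 'I_n -> 'I_n -> {RV (P n) >-> R})
    (hX : forall n : nat, model01 D mu (X n)) :
  (fun n : nat => P n (unique_winner (fun i j => X n i j))) @ \oo --> 1%E.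
Proof.
have [_ D01 gt1 atom] := hD.
have [a [b [Da Db ab]]] : exists a b : R, [/\ D a, D b & a < b].
  by have [a [b [Da Db]]] := gt1; case: ltgtP => // ab _; [exists a, b|exists b, a].
have atom_gt0 x : D x -> 0 < fine (mu [set x]).
  move=> Dx; rewrite fine_gt0// atom//= (le_lt_trans (probability_le1 _ _)) ?ltry//.
have in01 x : D x -> 0 <= x <= 1 by move=> /D01; rewrite /= in_itv.
have fP n : P n (unique_winner (fun i j => X n i j)) \is a fin_num.
  by apply: fin_num_measure; exact: measurable_unique_winner.
apply/fine_cvgP; split; first exact: nearW.
apply/cvgrPdist_le => eps eps0.
have c0 : 0 < b - a by rewrite subr_gt0.
have [N0 H] := clear_winner_whp (atom_gt0 a Da) (atom_gt0 b Db) c0 eps0.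
exists N0.+2 => // n /= N0n.
have lb : ((1 - eps)%:E <= P n (unique_winner (fun i j => X n i j)))%E.
  have [N nE] : exists N, n = N.+2 by exists n.-2; case: n N0n => [|[]].
  subst n; have {}/H H : (N0 <= N)%N by [].
  have [W [pr [zeta [pr0 pr1 indep ge]]]] := discretization a b D01 (hX N.+2).
  apply: le_trans ge; rewrite lee_fin; apply: (H _ _ _ _ None (Some None)) indep => //.
  - by move=> l; exact/fine_ge0/measure_ge0.
  - apply/EFin_inj.
    rewrite -(probability_finite_valued mu (@measurable_letter R a b N.+1) predT).
    by rewrite -(probability_setT mu); congr (mu _); apply/seteqP; split.
  - by move=> l; apply: letter_value_01; exact: in01.
  - congr (fine (mu _)); apply/seteqP; split=> x /=; rewrite /letter.
      by case: eqP => //; case: eqP.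
    by move=> ->; rewrite eqxx.
  - congr (fine (mu _)); apply/seteqP; split=> x /=; rewrite /letter.
      by case: eqP => //; case: eqP.
    by move=> ->; rewrite eqxx (gt_eqF ab).
have ub := probability_le1 (P n) (measurable_unique_winner (X n)).
rewrite ger0_norm ?subr_ge0; last by rewrite -lee_fin fineK.
by move: lb; rewrite -[X in (_ <= X)%E]fineK// lee_fin; lra.
Qed.
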